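(* Let $\Pi$ be a transduction downset. Then $\overline{\mbox{\sf loc-}\Pi}$ is a transduction downset.
   Context: Graphs are finite, undirected and loopless; a class of graphs is a set of graphs considered up to isomorphism, and every class contains the empty graph. A class property is a set of classes of graphs. For a set $\mathcal U$ of unary relation symbols, a $\mathcal U$-colored graph is a graph with additional unary relations in $\mathcal U$. Formulas are first-order, with adjacency relation $E$. Transductions. For a positive integer $k$, the $k$-copy operation $\mathsf C_k$ maps a graph $G$ to the graph consisting of $k$ copies of $G$ in which the $k$ copies of each vertex are made pairwise adjacent (no other edges between the copies). The coloring operation $\Gamma_{\mathcal U}$ maps a graph to the set of all its $\mathcal U$-expansions. A simple interpretation $\mathsf I=(\nu(x),\eta(x,y))$ of graphs in $\mathcal U$-colored graphs is a pair of first-order formulas with $\eta$ symmetric and anti-reflexive; $\mathsf I(G^+)$ is the graph with vertex set $\nu(G^+)$ and edge set $\eta(G^+)\cap\nu(G^+)^2$. A transduction is a composition $\mathsf T=\mathsf I\circ\Gamma_{\mathcal U}\circ\mathsf C_k$, so $\mathsf T(G)=\{\mathsf I(G^+): G^+\in\Gamma_{\mathcal U}(\mathsf C_k(G))\}$. For a class $\mathscr D$, $\mathsf T(\mathscr D)=\bigcup_{G\in\mathscr D}\mathsf T(G)$ up to isomorphism. $\mathscr C$ is a transduction of $\mathscr D$ if $\mathscr C\subseteq\mathsf T(\mathscr D)$ for some transduction $\mathsf T$. A class property $\Pi$ is a transduction downset if it is preserved by transductions: if $\mathscr D\in\Pi$ and $\mathscr C$ is a transduction of $\mathscr D$, then $\mathscr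 C\in\Pi$. Perturbations. A subset complementation is the transduction that chooses a subset $M$ of vertices (a unary relation) and complements the adjacency inside $M$. A perturbation is a composition of a bounded number of subset complementations. A class $\mathscr C$ is a perturbation of $\mathscr D$ if $\mathscr C\subseteq\mathsf P(\mathscr D)$ for some perturbation $\mathsf P$. Local properties. $B_d^G(v)$ is the subgraph of $G$ induced by the vertices at distance at most $d$ from $v$. $\mbox{\sf loc-}\Pi$ is the set of all classes $\mathscr C$ such that for every integer $d$ the class $\{B_d^G(v): G\in\mathscr C, v\in V(G)\}$ of all balls of radius $d$ of graphs in $\mathscr C$ belongs to $\Pi$. $\overline{\mbox{\sf loc-}\Pi}$ is the set of all classes that are perturbations of a class in $\mbox{\sf loc-}\Pi$. *)

(* Defs.v *)
From HB Require Import structures.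
From mathcomp Require Import all_boot.

Set Implicit Arguments.
Unset Strict Implicit.
Unset Printing Implicit Defensive.

Record graph := Graph {
  vertex :> finType;
  adj : rel vertex;
  adj_sym : symmetric adj;
  adj_irr : irreflexive adj }.

Definition iso (G H : graph) : Prop :=
  exists2 f : G -> H, bijective f & forall x y, adj (f x) (f y) = adj x y.

Section Induced.
Variables (G : graph) (S : {set G}).

Definition induced_adj : rel {x : G | x \in S} :=
  fun x y => adj (val x) (val y).

Lemma induced_sym : symmetric induced_adj.
Proof. by move=> x y; apply: adj_sym. Qed.

Lemma induced_irr : irreflexive induced_adj.
Proof. by move=> x; apply: adj_irr. Qed.

Definition induced : graph := Graph induced_sym induced_irr.
End Induced.

(* dist(u, v) <= d; the distance between components is infinite. *)
Definition dist_le (G : graph) (d : nat) (u v : G) : bool :=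
  [exists n : 'I_d.+1, exists p : n.-tuple G,
     path (@adj G) u p && (last u p == v)].

Definition ball (G : graph) (d : nat) (v : G) : graph :=
  induced [set u | dist_le d v u].

Section Copies.
Variables (G : graph) (k : nat).

Definition copies_adj : rel (G * 'I_k) := fun x y =>
  ((x.2 == y.2) && adj x.1 y.1) || ((x.1 == y.1) && (x.2 != y.2)).

Lemma copies_sym : symmetric copies_adj.
Proof. by move=> x y; rewrite /copies_adj adj_sym (eq_sym x.1) (eq_sym x.2).
Qed.

Lemma copies_irr : irreflexive copies_adj.
Proof. by move=> x; rewrite /copies_adj !eqxx adj_irr. Qed.

Definition copies : graph := Graph copies_sym copies_irr.
End Copies.

(* First-order formulas with unary symbols in U and free variables in 'I_n.
   Bound variables are de Bruijn indices: FAll binds variable 0 and shifts the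
   others by one. *)

Inductive formula (U : Type) : nat -> Type :=
| FEq n of 'I_n & 'I_n : formula U n
| FAdj n of 'I_n & 'I_n : formula U n
| FCol n of U & 'I_n : formula U n
| FNot n of formula U n : formula U n
| FAnd n of formula U n & formula U n : formula U n
| FAll n of formula U n.+1 : formula U n.

Arguments FEq {U n}.
Arguments FAdj {U n}.
Arguments FCol {U n}.

Definition coloring (U : Type) (G : graph) := U -> {set G}.

Fixpoint holds U (G : graph) (c : coloring U G) n (f : formula U n) :
    n.-tuple G -> bool :=
  match f with
  | FEq _ i j => fun e => tnth e i == tnth e j
  | FAdj _ i j => fun e => adj (tnth e i) (tnth e j)
  | FCol _ u i => fun e => tnth e i \in c u
  | FNot _ f1 => fun e => ~~ holds c f1 e
  | FAnd _ f1 f2 => fun e => holds c f1 e && holds c f2 e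
  | FAll _ f1 => fun e => [forall x : G, holds c f1 [tuple of x :: e]]
  end.

Record interpretation (U : Type) := Interpretation {
  nu : formula U 1;
  eta : formula U 2;
  eta_sym : forall (G : graph) (c : coloring U G) (x y : G),
    holds c eta [tuple x; y] = holds c eta [tuple y; x];
  eta_irr : forall (G : graph) (c : coloring U G) (x : G),
    holds c eta [tuple x; x] = false }.

Section Interpret.
Variables (U : Type) (I : interpretation U) (G : graph) (c : coloring U G).

Definition eta_graph : graph :=
  @Graph G (fun x y => holds c (eta I) [tuple x; y])
    (eta_sym I c) (eta_irr I c).

Definition interpret : graph :=
  @induced eta_graph [set x : G | holds c (nu I) [tuple x]].
End Interpret.

Record transduction := Transduction {
  ncopies : nat;
  ncopies_gt0 : 0 < ncopies;
  symbols : Type;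
  interp : interpretation symbols }.

(* H belongs, up to isomorphism, to T(G). *)
Definition transduces (T : transduction) (G H : graph) : Prop :=
  exists c : coloring (symbols T) (copies G (ncopies T)),
    iso H (interpret (interp T) c).

Record graph_class := GraphClass {
  in_class :> graph -> Prop;
  class_iso : forall G H, iso G H -> in_class G -> in_class H;
  class_empty : forall G : graph, #|G| = 0 -> in_class G }.

Definition class_property := graph_class -> Prop.

Definition transduction_of (C D : graph_class) : Prop :=
  exists T : transduction, forall H, C H -> exists2 G, D G & transduces T G H.

Definition transduction_downset (P : class_property) : Prop :=
  forall C D : graph_class, P D -> transduction_of C D -> P C.

(* x != y /\ (E(x,y) xor (M(x) /\ M(y))), with M the only unary symbol and xor
   written as ~(a /\ b) /\ ~(~a /\ ~b). *)
Definition compl_eta : formula unit 2 :=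
  let x : 'I_2 := ord0 in let y : 'I_2 := ord_max in
  let a := FAdj x y in let b := FAnd (FCol tt x) (FCol tt y) in
  FAnd (FNot (FEq x y)) (FAnd (FNot (FAnd a b)) (FNot (FAnd (FNot a) (FNot b)))).

Lemma compl_etaE (G : graph) (c : coloring unit G) (x y : G) :
  holds c compl_eta [tuple x; y] =
  (x != y) && (adj x y (+) ((x \in c tt) && (y \in c tt))).
Proof.
rewrite /= (_ : tnth _ ord0 = x) // (_ : tnth _ ord_max = y) //.
by case: (_ == _); case: (adj x y); case: (x \in _); case: (y \in _).
Qed.

Lemma compl_eta_sym (G : graph) (c : coloring unit G) (x y : G) :
  holds c compl_eta [tuple x; y] = holds c compl_eta [tuple y; x].
Proof. by rewrite !compl_etaE eq_sym adj_sym [X in _ (+) X]andbC. Qed.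

Lemma compl_eta_irr (G : graph) (c : coloring unit G) (x : G) :
  holds c compl_eta [tuple x; x] = false.
Proof. by rewrite compl_etaE eqxx. Qed.

Definition subset_complementation : transduction :=
  @Transduction 1 isT unit
    (@Interpretation unit (FEq ord0 ord0) compl_eta
       compl_eta_sym compl_eta_irr).

Fixpoint perturbs (m : nat) (G H : graph) : Prop :=
  if m is m'.+1 then
    exists2 G', transduces subset_complementation G G' & perturbs m' G' H
  else iso G H.

Definition perturbation_of (C D : graph_class) : Prop :=
  exists m : nat, forall H, C H -> exists2 G, D G & perturbs m G H.

Lemma iso_trans G H K : iso G H -> iso H K -> iso G K.
Proof.
move=> [f bf fE] [g bg gE]; exists (g \o f); first exact: bij_comp.
by move=> x y; rewrite /= gE fE.
Qed.

Section Balls.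
Variables (d : nat) (C : graph_class).

(* The empty graph, which is never a ball, is added because every class
   contains it. *)
Definition in_balls (H : graph) : Prop :=
  #|H| = 0 \/ exists (G : graph) (v : G), C G /\ iso (ball d v) H.

Lemma in_balls_iso G H : iso G H -> in_balls G -> in_balls H.
Proof.
move=> GH [G0|[K [v [CK KG]]]]; last first.
  by right; exists K, v; split=> //; apply: iso_trans KG GH.
by left; case: GH => f bf _; rewrite -(bij_eq_card bf).
Qed.

Lemma in_balls_empty (G : graph) : #|G| = 0 -> in_balls G.
Proof. by left. Qed.

Definition balls : graph_class := GraphClass in_balls_iso in_balls_empty.
End Balls.

Definition loc (P : class_property) : class_property :=
  fun C => forall d : nat, P (balls d C).

Definition perturbation_closure (P : class_property) : class_property :=
  fun C => exists2 D, P D & perturbation_of C D.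

(* Main.v *)
From HB Require Import structures.
From mathcomp Require Import all_boot.
Require Import Defs.

Set Implicit Arguments.
Unset Strict Implicit.
Unset Printing Implicit Defensive.

(* If D is a perturbation of D' in loc-P and C is a transduction of D, then a
   graph in C is interpreted in K = C_k(G), with G in D', after flipping the
   adjacency of K inside boundedly many sets. Once K is expanded by finitely
   many further colors, every formula with a free variable becomes local, i.e.
   all its quantifiers are guarded by a distance bound (Gaifman's theorem,
   which extra colors make purely local). A local formula f(x, y) restricted
   to pairs at a large distance is a disjunction of products a(x) b(y), hence
   it agrees there with the parity of the number of sets in some bounded family
   that contain both x and y. Thus the interpreted graph is a perturbation of
   the graph H' of the pairs at small distance on which f and that parity
   differ. A ball of H' is the image of a ball of G with a larger radius by
   the very interpretation that defines H', so the class of the graphs H' is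
   in loc-P. *)

(** * Distances and local formulas *)

Lemma dist_leP (G : graph) d (u v : G) :
  reflect (exists p, [/\ size p <= d, path (@adj G) u p & last u p = v])
          (dist_le d u v).
Proof.
apply: (iffP existsP) => [[n /existsP[p /andP[up /eqP pv]]]|[p [pd up pv]]].
  by exists p; rewrite size_tuple -ltnS ltn_ord.
exists (Ordinal (pd : size p < d.+1)); apply/existsP; exists (in_tuple p).
by rewrite up pv eqxx.
Qed.

Lemma dist_le0 (G : graph) d (u : G) : dist_le d u u.
Proof. by apply/dist_leP; exists [::]. Qed.

Lemma dist_le1 (G : graph) (u v : G) : adj u v -> dist_le 1 u v.
Proof. by move=> uv; apply/dist_leP; exists [:: v]; rewrite /= uv. Qed.

Lemma dist_le_sub (G : graph) d d' (u v : G) :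
  d <= d' -> dist_le d u v -> dist_le d' u v.
Proof.
move=> dd /dist_leP[p [pd up pv]]; apply/dist_leP; exists p; split=> //.
exact: leq_trans dd.
Qed.

Lemma dist_le_trans (G : graph) d d' (u v w : G) :
  dist_le d u v -> dist_le d' v w -> dist_le (d + d') u w.
Proof.
move=> /dist_leP[p [pd up pv]] /dist_leP[q [qd vq qw]]; apply/dist_leP.
by exists (p ++ q); rewrite size_cat leq_add // cat_path up pv vq last_cat pv.
Qed.

Lemma dist_le_sym (G : graph) d (u v : G) : dist_le d u v = dist_le d v u.
Proof.
suff imp (x y : G) : dist_le d x y -> dist_le d y x by apply/idP/idP; apply: imp.
case/dist_leP=> p [pd xp <-]; apply/dist_leP; exists (rev (belast x p)).
rewrite size_rev size_belast (eq_path (adj_sym (g := G))) rev_path xp; split=> //.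
by case: p {pd xp} => //= a p; rewrite rev_cons last_rcons.
Qed.

Lemma dist_le_map (G H : graph) (f : G -> H) r d (u v : G) :
  (forall x y, adj x y -> dist_le r (f x) (f y)) ->
  dist_le d u v -> dist_le (d * r) (f u) (f v).
Proof.
move=> fE /dist_leP[p [pd up <-]].
apply: (dist_le_sub (leq_mul pd (leqnn r))).
elim: p u up {pd} => [|w p IH] u /=; first by rewrite dist_le0.
by case/andP=> /fE uw /IH; rewrite mulSn; apply: dist_le_trans uw.
Qed.

Section Embedding.
Variables (K G : graph) (f : K -> G).
Hypothesis f_inj : injective f.
Hypothesis f_adj : forall x y, adj (f x) (f y) = adj x y.

Definition covers r (v : G) := forall y, dist_le r v y -> exists x, f x = y.

Lemma covers_sub r r' v w d :
  dist_le d v w -> d + r' <= r -> covers r v -> covers r' w.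
Proof.
move=> vw dr cv y wy; apply: cv; apply: dist_le_sub dr _.
exact: dist_le_trans vw wy.
Qed.

(** A walk of length at most [d] from [f u] stays in the image, so it lifts to [K] step by step;
    each step uses up one unit of the covered radius. *)
Lemma dist_le_embed d (u v : K) :
  covers d (f u) -> dist_le d (f u) (f v) = dist_le d u v.
Proof.
move=> cu; apply/idP/idP => [|uv]; last first.
  rewrite -[d]muln1; apply: dist_le_map uv => x y xy.
  by apply: dist_le1; rewrite f_adj.
case/dist_leP=> p; elim: p d u cu => [|w p IH] d u cu [/= pd fup fuv].
  by rewrite (f_inj fuv) dist_le0.
case/andP: fup => fuw wp; case: d pd cu => // d pd cu.
have [x xw] := cu w (dist_le_sub (isT : 0 < d.+1) (dist_le1 fuw)).
rewrite -xw in fuw wp fuv.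
have ux : dist_le 1 u x by apply: dist_le1; rewrite -f_adj.
apply: (dist_le_trans (d := 1) ux); apply: IH; last by [].
by apply: covers_sub (dist_le1 fuw) _ cu.
Qed.

End Embedding.

(** [LEx i s] quantifies over the ball of radius [s] around variable [i] and binds index 0. [LTrue]
    serves as the trivial factor when a formula is split into products. *)
Inductive lform (U : Type) : nat -> Type :=
| LTrue n : lform U n
| LEq n of 'I_n & 'I_n : lform U n
| LAdj n of 'I_n & 'I_n : lform U n
| LCol n of U & 'I_n : lform U n
| LNot n of lform U n : lform U n
| LAnd n of lform U n & lform U n : lform U n
| LEx n of 'I_n & nat & lform U n.+1 : lform U n.

Arguments LTrue {U n}.
Arguments LEq {U n}.
Arguments LAdj {U n}.
Arguments LCol {U n}.

Fixpoint lholds U (G : graph) (c : coloring U G) n (f : lform U n) :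
    n.-tuple G -> bool :=
  match f with
  | LTrue _ => fun=> true
  | LEq _ i j => fun e => tnth e i == tnth e j
  | LAdj _ i j => fun e => adj (tnth e i) (tnth e j)
  | LCol _ u i => fun e => tnth e i \in c u
  | LNot _ f1 => fun e => ~~ lholds c f1 e
  | LAnd _ f1 f2 => fun e => lholds c f1 e && lholds c f2 e
  | LEx _ i s f1 => fun e =>
      [exists x : G, dist_le s (tnth e i) x && lholds c f1 [tuple of x :: e]]
  end.

(** Bounds how far around its free variables a formula looks. Adjacency counts 1, so that it fails
    between points at distance larger than the radius. *)
Fixpoint radius U n (f : lform U n) : nat :=
  match f with
  | LAdj _ _ _ => 1
  | LNot _ f1 => radius f1
  | LAnd _ f1 f2 => maxn (radius f1) (radius f2)
  | LEx _ _ s f1 => s + radius f1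
  | _ => 0
  end.

Fixpoint lmap U V (h : U -> V) n (f : lform U n) : lform V n :=
  match f with
  | LTrue _ => LTrue
  | LEq _ i j => LEq i j
  | LAdj _ i j => LAdj i j
  | LCol _ u i => LCol (h u) i
  | LNot _ f1 => LNot (lmap h f1)
  | LAnd _ f1 f2 => LAnd (lmap h f1) (lmap h f2)
  | LEx _ i s f1 => LEx i s (lmap h f1)
  end.

Lemma lholds_map U V (h : U -> V) (G : graph) (c : coloring V G) n
    (f : lform U n) (e : n.-tuple G) :
  lholds c (lmap h f) e = lholds (fun u => c (h u)) f e.
Proof.
elim: f e => //= {n} [n f IH|n f IHf g IHg|n i s f IH] e; first by rewrite IH.
  by rewrite IHf IHg.
by apply: eq_existsb => x; rewrite IH.
Qed.

Definition under n m (r : 'I_n -> 'I_m) (k : 'I_n.+1) : 'I_m.+1 :=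
  if unlift ord0 k is Some k' then lift ord0 (r k') else ord0.

Fixpoint lrename U n (f : lform U n) : forall m, ('I_n -> 'I_m) -> lform U m :=
  match f with
  | LTrue _ => fun m r => LTrue
  | LEq _ i j => fun m r => LEq (r i) (r j)
  | LAdj _ i j => fun m r => LAdj (r i) (r j)
  | LCol _ u i => fun m r => LCol u (r i)
  | LNot _ f1 => fun m r => LNot (lrename f1 r)
  | LAnd _ f1 f2 => fun m r => LAnd (lrename f1 r) (lrename f2 r)
  | LEx _ i s f1 => fun m r => LEx (r i) s (lrename f1 (under r))
  end.

Lemma lholds_rename U (G : graph) (c : coloring U G) n (f : lform U n) m
    (r : 'I_n -> 'I_m) (e : m.-tuple G) :
  lholds c (lrename f r) e = lholds c f [tuple tnth e (r i) | i < n].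
Proof.
elim: f m r e => //= {n}
  [n i j|n i j|n u i|n f IH|n f IHf g IHg|n i s f IH] m r e;
  rewrite ?tnth_mktuple ?IH ?IHf ?IHg //.
apply: eq_existsb => x; rewrite IH; congr (_ && lholds c f _).
apply: eq_from_tnth => k; rewrite tnth_mktuple /under.
by case: unliftP => [k'|] ->; rewrite ?tnthS ?tnth0 ?tnth_mktuple.
Qed.

(** A guarded witness lies in the covered ball, hence has a preimage, and the radius left after
    subtracting the guard still covers what the body sees from it. *)
Lemma lholds_embed U (K G : graph) (h : K -> G) (cK : coloring U K)
    (cG : coloring U G) :
  injective h -> (forall x y, adj (h x) (h y) = adj x y) ->
  (forall u x, (x \in cK u) = (h x \in cG u)) ->
  forall n (f : lform U n) (e : n.-tuple K),
  (forall i, covers h (radius f) (h (tnth e i))) ->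
  lholds cG f [tuple of map h e] = lholds cK f e.
Proof.
move=> h_inj h_adj h_col n.
elim=> {n} [n|n i j|n i j|n u i|n f IH|n f IHf g IHg|n i s f IH] e /= cov;
  rewrite ?tnth_map ?h_adj ?h_col ?(inj_eq h_inj) ?IH //.
  rewrite IHf ?IHg // => i; apply: covers_sub (dist_le0 0 _) _ (cov i);
    by rewrite add0n leq_max leqnn ?orbT.
have covs : covers h s (h (tnth e i)).
  by apply: covers_sub (dist_le0 0 _) _ (cov i); rewrite leq_addr.
have covx x : dist_le s (tnth e i) x ->
    forall j, covers h (radius f) (h (tnth [tuple of x :: e] j)).
  move=> ix j; case: (unliftP ord0 j) => [k|] ->; rewrite ?tnthS ?tnth0.
    by apply: covers_sub (dist_le0 0 _) _ (cov k); rewrite leq_addl.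
  by apply: covers_sub _ (leqnn _) (cov i); rewrite dist_le_embed.
apply/existsP/existsP => [[y /andP[iy fy]]|[x /andP[ix fx]]].
  have [x xy] := covs y iy; exists x; move: iy fy.
  rewrite -xy dist_le_embed // => ix; rewrite ix /= -IH; last exact: covx.
  by congr (lholds _ _ _); apply: val_inj.
exists (h x); rewrite dist_le_embed // ix /=; move: fx.
rewrite -IH; last exact: covx.
by congr (lholds _ _ _); apply: val_inj.
Qed.

Definition lOr U n (f g : lform U n) := LNot (LAnd (LNot f) (LNot g)).
Definition lXor U n (f g : lform U n) :=
  lOr (LAnd f (LNot g)) (LAnd (LNot f) g).
Definition lAny U n (s : seq (lform U n)) := foldr (@lOr U n) (LNot LTrue) s.
Definition lAll U n (s : seq (lform U n)) := foldr (@LAnd U n) LTrue s.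
Definition lDist U n s (i j : 'I_n) : lform U n :=
  LEx i s (LEq ord0 (lift ord0 j)).

Section Connectives.
Variables (U : Type) (G : graph) (c : coloring U G) (n : nat).
Implicit Types (f g : lform U n) (e : n.-tuple G).

Lemma lholds_not f e : lholds c (LNot f) e = ~~ lholds c f e.
Proof. by []. Qed.

Lemma lholds_and f g e : lholds c (LAnd f g) e = lholds c f e && lholds c g e.
Proof. by []. Qed.

Lemma lholds_col u i e : lholds c (LCol u i) e = (tnth e i \in c u).
Proof. by []. Qed.

Lemma lholds_ex i s (f : lform U n.+1) e : lholds c (LEx i s f) e =
  [exists x, dist_le s (tnth e i) x && lholds c f [tuple of x :: e]].
Proof. by []. Qed.

Lemma lholds_or f g e : lholds c (lOr f g) e = lholds c f e || lholds c g e.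
Proof. by rewrite /= negb_and !negbK. Qed.

Lemma lholds_xor f g e : lholds c (lXor f g) e = lholds c f e (+) lholds c g e.
Proof. by rewrite lholds_or /=; do 2 case: lholds. Qed.

Lemma lholds_any fs e : lholds c (lAny fs) e = has (fun f => lholds c f e) fs.
Proof. by elim: fs => //= f fs <-; rewrite negb_and !negbK. Qed.

Lemma lholds_all fs e : lholds c (lAll fs) e = all (fun f => lholds c f e) fs.
Proof. by elim: fs => //= f fs <-. Qed.

Lemma lholds_dist s (i j : 'I_n) e :
  lholds c (lDist U s i j) e = dist_le s (tnth e i) (tnth e j).
Proof.
apply/existsP/idP => [[x]|ij]; last exists (tnth e j).
  by rewrite /= tnthS tnth0 => /andP[ix /eqP <-].
by rewrite /= tnthS tnth0 ij eqxx.
Qed.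

End Connectives.


Definition lholdsE := (lholds_not, lholds_and, lholds_col, lholds_ex, lholds_or,
  lholds_xor, lholds_any, lholds_all, lholds_dist).

(** * Feferman-Vaught splitting and scattered sets *)

(** The map [s] deals the variables into two blocks; an arbitrary map is allowed so that the split
    can be extended under binders. *)
Definition joint (T : Type) n a b (s : 'I_n -> 'I_a + 'I_b) (e1 : a.-tuple T)
    (e2 : b.-tuple T) : n.-tuple T :=
  [tuple match s k with inl i => tnth e1 i | inr j => tnth e2 j end | k < n].

Definition put_left n a b (s : 'I_n -> 'I_a + 'I_b) (k : 'I_n.+1) :
    'I_a.+1 + 'I_b :=
  if unlift ord0 k is Some k' then
    match s k' with inl i => inl (lift ord0 i) | inr j => inr j end
  else inl ord0.

Definition put_right n a b (s : 'I_n -> 'I_a + 'I_b) (k : 'I_n.+1) :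
    'I_a + 'I_b.+1 :=
  if unlift ord0 k is Some k' then
    match s k' with inl i => inl i | inr j => inr (lift ord0 j) end
  else inr ord0.

Lemma joint_put_left (T : Type) n a b (s : 'I_n -> 'I_a + 'I_b)
    (e1 : a.-tuple T) (e2 : b.-tuple T) x :
  joint (put_left s) [tuple of x :: e1] e2 = [tuple of x :: joint s e1 e2].
Proof.
apply: eq_from_tnth => k; rewrite tnth_mktuple /put_left.
case: unliftP => [k'|] ->; rewrite ?tnthS ?tnth0 // tnth_mktuple.
by case: (s k') => // i; rewrite tnthS.
Qed.

Lemma joint_put_right (T : Type) n a b (s : 'I_n -> 'I_a + 'I_b)
    (e1 : a.-tuple T) (e2 : b.-tuple T) x :
  joint (put_right s) e1 [tuple of x :: e2] = [tuple of x :: joint s e1 e2].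
Proof.
apply: eq_from_tnth => k; rewrite tnth_mktuple /put_right.
case: unliftP => [k'|] ->; rewrite ?tnthS ?tnth0 // tnth_mktuple.
by case: (s k') => // i; rewrite tnthS.
Qed.

Definition far (G : graph) r a b (e1 : a.-tuple G) (e2 : b.-tuple G) :=
  forall i j, ~~ dist_le r (tnth e1 i) (tnth e2 j).

Lemma far_sub (G : graph) r r' a b (e1 : a.-tuple G) (e2 : b.-tuple G) :
  r <= r' -> far r' e1 e2 -> far r e1 e2.
Proof. by move=> rr f i j; apply: contra (f i j); apply: dist_le_sub. Qed.

Lemma far_sym (G : graph) r a b (e1 : a.-tuple G) (e2 : b.-tuple G) :
  far r e1 e2 -> far r e2 e1.
Proof. by move=> f i j; rewrite dist_le_sym. Qed.

Lemma far_cons (G : graph) s r a b (e1 : a.-tuple G) (e2 : b.-tuple G) i x :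
  far (s + r) e1 e2 -> dist_le s (tnth e1 i) x -> far r [tuple of x :: e1] e2.
Proof.
move=> f ix k j; case: (unliftP ord0 k) => [k'|] ->; rewrite ?tnthS ?tnth0.
  by apply: far_sub f k' j; rewrite leq_addl.
by apply: contra (f i j); apply: dist_le_trans.
Qed.

Lemma has_andl T (b : bool) (P : pred T) l :
  has (fun p => b && P p) l = b && has P l.
Proof. by case: b => //=; elim: l. Qed.

Lemma exists_andr (T : finType) (b : bool) (P : pred T) :
  [exists x, P x && b] = [exists x, P x] && b.
Proof.
case: b; first by rewrite andbT; apply: eq_existsb => x; rewrite andbT.
by rewrite andbF; apply/existsP=> -[x]; rewrite andbF.
Qed.

Lemma exists_has (T : finType) S (P : S -> pred T) l :
  [exists x, has (P^~ x) l] = has (fun p => [exists x, P p x]) l.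
Proof.
elim: l => [|p l IH] /=; first by apply/existsP=> -[].
rewrite -IH; apply/existsP/orP => [[x /orP[px|lx]]|[/existsP[x px]|/existsP[x lx]]].
- by left; apply/existsP; exists x.
- by right; apply/existsP; exists x.
- by exists x; rewrite px.
- by exists x; rewrite lx orbT.
Qed.

(** Feferman-Vaught normal form: a disjunction of products, each factor seeing only one of the two
    tuples. *)
Definition lsum U a b (l : seq (lform U a * lform U b)) (G : graph)
    (c : coloring U G) (e1 : a.-tuple G) (e2 : b.-tuple G) :=
  has (fun p => lholds c p.1 e1 && lholds c p.2 e2) l.

Lemma lsum_not U a b (l : seq (lform U a * lform U b)) : exists l',
  forall (G : graph) (c : coloring U G) e1 e2,
  lsum l' c e1 e2 = ~~ lsum l c e1 e2.
Proof.
elim: l => [|[f g] l [l' lE]]; first by exists [:: (LTrue, LTrue)].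
exists ([seq (LAnd (LNot f) p.1, p.2) | p <- l']
        ++ [seq (p.1, LAnd (LNot g) p.2) | p <- l']) => G c e1 e2.
rewrite /lsum has_cat !has_map /= negb_or -[~~ has _ l]lE /lsum negb_and.
elim: l' {lE} => [|p l' /= IH] /=; first by rewrite andbF.
rewrite orbACA IH.
by case: (lholds c f e1); case: (lholds c g e2); rewrite /= ?andbF ?orbF ?orbb.
Qed.

Lemma lsum_and U a b (l1 l2 : seq (lform U a * lform U b)) : exists l',
  forall (G : graph) (c : coloring U G) e1 e2,
  lsum l' c e1 e2 = lsum l1 c e1 e2 && lsum l2 c e1 e2.
Proof.
have [m1 E1] := lsum_not l1; have [m2 E2] := lsum_not l2.
have [m E] := lsum_not (m1 ++ m2); exists m => G c e1 e2.
by rewrite E /lsum has_cat negb_or -!/(lsum _ _ _ _) E1 E2 !negbK.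
Qed.

(** Across far tuples equality and adjacency are false. A guarded witness is close to its anchor,
    hence far from the other block at the smaller radius of the body; it joins the block of the
    anchor, and the quantifier distributes over the disjunction, acting on one factor of each
    product. *)
Lemma lform_split U n (f : lform U n) : forall a b (s : 'I_n -> 'I_a + 'I_b),
  exists l : seq (lform U a * lform U b),
  forall (G : graph) (c : coloring U G) e1 e2, far (radius f) e1 e2 ->
  lholds c f (joint s e1 e2) = lsum l c e1 e2.
Proof.
elim: f => {n}
  [n|n i j|n i j|n u i|n f IH|n f IHf g IHg|n i d f IH] a b s /=.
- by exists [:: (LTrue, LTrue)].
- case si: (s i) => [i'|i']; case sj: (s j) => [j'|j'].
  + exists [:: (LEq i' j', LTrue)] => G c e1 e2 _.
    by rewrite /lsum /= !tnth_mktuple si sj andbT orbF.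
  + exists [::] => G c e1 e2 e12; rewrite /lsum /= !tnth_mktuple si sj.
    by apply/eqP=> xy; move/negP: (e12 i' j'); rewrite xy dist_le0.
  + exists [::] => G c e1 e2 e12; rewrite /lsum /= !tnth_mktuple si sj.
    by apply/eqP=> xy; move/negP: (e12 j' i'); rewrite xy dist_le0.
  + exists [:: (LTrue, LEq i' j')] => G c e1 e2 _.
    by rewrite /lsum /= !tnth_mktuple si sj orbF.
- case si: (s i) => [i'|i']; case sj: (s j) => [j'|j'].
  + exists [:: (LAdj i' j', LTrue)] => G c e1 e2 _.
    by rewrite /lsum /= !tnth_mktuple si sj andbT orbF.
  + exists [::] => G c e1 e2 e12; rewrite /lsum /= !tnth_mktuple si sj.
    by apply/negP=> /dist_le1 xy; move/negP: (e12 i' j').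
  + exists [::] => G c e1 e2 e12; rewrite /lsum /= !tnth_mktuple si sj.
    by rewrite adj_sym; apply/negP=> /dist_le1 xy; move/negP: (e12 j' i').
  + exists [:: (LTrue, LAdj i' j')] => G c e1 e2 _.
    by rewrite /lsum /= !tnth_mktuple si sj orbF.
- case si: (s i) => [i'|i'].
  + exists [:: (LCol u i', LTrue)] => G c e1 e2 _.
    by rewrite /lsum /= !tnth_mktuple si andbT orbF.
  + exists [:: (LTrue, LCol u i')] => G c e1 e2 _.
    by rewrite /lsum /= !tnth_mktuple si orbF.
- have [l lE] := IH a b s; have [l' l'E] := lsum_not l.
  by exists l' => G c e1 e2 e12; rewrite lE // l'E.
- have [lf fE] := IHf a b s; have [lg gE] := IHg a b s.
  have [l lE] := lsum_and lf lg; exists l => G c e1 e2 e12.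
  by rewrite lE fE ?gE //; apply: far_sub e12; rewrite leq_max leqnn ?orbT.
case si: (s i) => [i'|i'].
  have [l lE] := IH _ _ (put_left s).
  exists [seq (LEx i' d p.1, p.2) | p <- l] => G c e1 e2 e12.
  rewrite /lsum has_map tnth_mktuple si.
  under eq_existsb => x.
    rewrite (_ : _ && _ = has (fun p => dist_le d (tnth e1 i') x &&
      (lholds c p.1 [tuple of x :: e1] && lholds c p.2 e2)) l); first over.
    rewrite has_andl; case: (boolP (dist_le _ _ _)) => //= ix.
    by rewrite -joint_put_left lE //; apply: far_cons ix.
  rewrite exists_has; apply: eq_has => p /=.
  by rewrite -exists_andr; apply: eq_existsb => x; rewrite andbA.
have [l lE] := IH _ _ (put_right s).
exists [seq (p.1, LEx i' d p.2) | p <- l] => G c e1 e2 e12.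
rewrite /lsum has_map tnth_mktuple si.
under eq_existsb => x.
  rewrite (_ : _ && _ = has (fun p => dist_le d (tnth e2 i') x &&
    (lholds c p.1 e1 && lholds c p.2 [tuple of x :: e2])) l); first over.
  rewrite has_andl; case: (boolP (dist_le _ _ _)) => //= ix.
  rewrite -joint_put_right lE //.
  by apply: far_sym; apply: far_cons ix; apply: far_sym.
rewrite exists_has; apply: eq_has => p /=.
rewrite andbC -exists_andr; apply: eq_existsb => x.
by rewrite [lholds c p.1 _ && _]andbC andbA.
Qed.

(** The formula is uniform in the graph, whereas the coloring may depend on the graph and its data
    [a], but not on the tuple. Global information is thereby stored in colors. *)
Definition localizable (A : graph -> Type) n
    (Q : forall G : graph, A G -> n.-tuple G -> bool) : Prop :=
  exists (U : Type) (f : lform U n), forall (G : graph) (a : A G),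
  exists c : coloring U G, forall e, Q G a e = lholds c f e.

Section Localizable.
Variables (A : graph -> Type) (n : nat).
Implicit Types Q : forall G : graph, A G -> n.-tuple G -> bool.

Lemma localizable_not Q :
  localizable Q -> localizable (fun G a e => ~~ Q G a e).
Proof.
case=> U [f fE]; exists U, (LNot f) => G a; have [c cE] := fE G a.
by exists c => e /=; rewrite cE.
Qed.

Lemma localizable_and Q Q' : localizable Q -> localizable Q' ->
  localizable (fun G a e => Q G a e && Q' G a e).
Proof.
case=> U [f fE] [V [g gE]].
exists (U + V)%type, (LAnd (lmap inl f) (lmap inr g)) => G a.
have [c cE] := fE G a; have [d dE] := gE G a.
exists (fun w => match w with inl u => c u | inr v => d v end) => e /=.
by rewrite !lholds_map cE dE.
Qed.

Lemma localizable_or Q Q' : localizable Q -> localizable Q' ->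
  localizable (fun G a e => Q G a e || Q' G a e).
Proof.
move=> lQ lQ'; have [U [f fE]] := localizable_not
  (localizable_and (localizable_not lQ) (localizable_not lQ')).
exists U, f => G a; have [c cE] := fE G a.
by exists c => e; rewrite -cE negb_and !negbK.
Qed.

Lemma localizable_reduce Q (B : graph -> Type)
    (Q' : forall G : graph, B G -> n.-tuple G -> bool) :
  localizable Q' ->
  (forall (G : graph) (a : A G), exists b, forall e, Q G a e = Q' G b e) ->
  localizable Q.
Proof.
case=> U [f fE] QQ; exists U, f => G a; have [b bE] := QQ G a.
by have [c cE] := fE G b; exists c => e; rewrite bE cE.
Qed.

End Localizable.

Lemma localizable_lform U n (f : lform U n) :
  localizable (fun (G : graph) (c : coloring U G) e => lholds c f e).
Proof. by exists U, f => G c; exists c. Qed.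

(** Greedy choice: a point of [P] far from the chosen ones is added until there are [m] of them or
    none remains to add. *)
Lemma scattered_subset (G : graph) r (P : {set G}) m : exists s : seq G,
  [/\ size s <= m, all [in P] s,
      pairwise (fun x y => ~~ dist_le r x y) s &
      size s = m \/ forall z, z \in P -> has (dist_le r z) s].
Proof.
elim: m => [|m [s [sm sP ss [E|E]]]]; first by exists [::]; split=> //; left.
- case: (boolP [forall z in P, has (dist_le r z) s]) => [/forall_inP cov|].
    by exists s; split=> //; [rewrite ltnW ?ltnS|right].
  rewrite negb_forall => /existsP[z]; rewrite negb_imply -all_predC.
  case/andP=> zP zs; exists (z :: s); rewrite /= zP sP ss E zs.
  by split=> //; left.
- by exists s; split=> //; [rewrite ltnW ?ltnS|right].
Qed.

Definition farb (G : graph) r n (e : n.-tuple G) (z : G) :=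
  [forall i, ~~ dist_le r (tnth e i) z].

(* A point of P far from e is either at distance at most 3r from e, which is
   local, or it can be replaced with a point of a set S of at most n + 2
   points of P, at distances larger than 2r from each other and maximal with
   this property. No point of e is close to two points of S, so S has a
   point far from e as soon as #|S| = n + 2. *)
Lemma localizable_far n r :
  localizable (fun (G : graph) (P : {set G}) (e : n.+1.-tuple G) =>
    [exists z in P, farb r e z]).
Proof.
exists (option 'I_n.+2), (lOr
  (lAny [seq LEx l (r + (r + r)) (LAnd (LCol None ord0)
     (lAll [seq LNot (lDist _ r (lift ord0 k) ord0) | k : 'I_n.+1]))
       | l : 'I_n.+1])
  (lAny [seq lAll [seq LNot (LCol (Some i) k) | k : 'I_n.+1]
       | i : 'I_n.+2])) => G P.
have [s [sn /allP sP ss smax]] :=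
  scattered_subset (r + r) P n.+2.
(* Color [Some i] is the ball around the [i]-th scattered point. If there is no such point, the
   implication makes it the whole graph, so that a missing point never passes for a far one. *)
pose c0 (i : option 'I_n.+2) := if i is Some i then
  [set x | (i < size s) ==> dist_le r (nth x s i) x] else P.
exists c0 => e.
rewrite lholds_or !lholds_any !has_map.
set Q1 := has _ _; set Q2 := has _ _.
have Q1P : reflect (exists l, exists2 z, z \in P &
    dist_le (r + (r + r)) (tnth e l) z && farb r e z) Q1.
  apply: (iffP hasP) => [[l _]|[l [z zP /andP[lz ez]]]].
    rewrite [preim _ _ _]lholds_ex => /existsP[z].
    rewrite !lholdsE tnth0 all_map => /and3P[lz zP /allP ez].
    exists l, z => //; rewrite lz; apply/forallP=> k.
    have := ez k; rewrite -?enumT mem_enum => /(_ isT).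
    by rewrite [preim _ _ _]lholds_not lholds_dist tnthS.
  exists l; first by rewrite -?enumT mem_enum.
  rewrite [preim _ _ _]lholds_ex; apply/existsP; exists z.
  rewrite lz !lholdsE tnth0 zP all_map; apply/allP=> k _.
  by rewrite [preim _ _ _]lholds_not lholds_dist tnth0 tnthS (forallP ez).
have Q2P : reflect (exists2 i : 'I_n.+2, i < size s &
    forall k x0, ~~ dist_le r (nth x0 s i) (tnth e k)) Q2.
  have colE i : lholds c0 (lAll [seq LNot (LCol (Some i) k) | k : 'I_n.+1]) e =
      [forall k, (i < size s) && ~~ dist_le r (nth (tnth e k) s i) (tnth e k)].
    rewrite lholds_all all_map; apply/allP/forallP => [ei k|ei k _].
      have := ei k; rewrite -?enumT mem_enum => /(_ isT).
      by rewrite [preim _ _ _]lholds_not lholds_col inE negb_imply.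
    by rewrite [preim _ _ _]lholds_not lholds_col inE negb_imply.
  apply: (iffP hasP) => [[i _]|[i si ei]].
    rewrite [preim _ _ _]colE => /forallP ei; exists i => [|k x0].
      by case/andP: (ei ord0).
    by case/andP: (ei k) => si; rewrite (set_nth_default x0).
  exists i; first by rewrite -?enumT mem_enum.
  by rewrite [preim _ _ _]colE; apply/forallP=> k; rewrite si ei.
apply/idP/orP => [/exists_inP[z zP ez]|[/Q1P[l [z zP /andP[_ ez]]]|]].
- case: smax => [sz|/(_ z zP) /hasP[y ys zy]].
    right; apply/Q2P.
    case: (boolP [exists i : 'I_n.+2,
      forall k, ~~ dist_le r (nth z s i) (tnth e k)]).
      case/existsP=> i /forallP ei; exists i => [|k x0]; rewrite ?sz //.
      by rewrite (set_nth_default z) ?sz.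
    rewrite negb_exists => /forallP near.
    (* Pigeonhole: [g] sends the [n.+2] scattered points to close entries among [n.+1], so two of
       them share an entry and are within [r + r] of each other. *)
    pose g (i : 'I_n.+2) :=
      odflt ord0 [pick k | dist_le r (nth z s i) (tnth e k)].
    have gP (i : 'I_n.+2) : dist_le r (nth z s i) (tnth e (g i)).
      rewrite /g; case: pickP => // ei; case/negP: (near i).
      by apply/forallP=> k; rewrite ei.
    have: ~~ injectiveb g.
      by apply/injectiveP=> /leq_card; rewrite !card_ord ltnn.
    case/injectivePn=> i [j ij gij]; wlog ltij : i j ij gij / i < j.
      move=> H; case: (ltngtP i j) => [| |/val_inj/eqP]; [exact: H| |].
        by apply: H; rewrite // eq_sym.
      by rewrite (negPf ij).
    have := pairwiseP z ss i j; rewrite !inE sz !ltn_ord.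
    move=> /(_ isT isT ltij) /negP[].
    by apply: dist_le_trans (gP i) _; rewrite dist_le_sym gij.
  case: (boolP [exists l, dist_le r (tnth e l) y]) => [/existsP[l ly]|].
    left; apply/Q1P; exists l, z => //; rewrite ez andbT.
    by apply: dist_le_trans ly _; rewrite dist_le_sym.
  rewrite negb_exists => /forallP ey; right; apply/Q2P.
  have ys' : index y s < n.+2 by apply: leq_trans sn; rewrite index_mem.
  exists (Ordinal ys') => [|k x0]; rewrite /= ?index_mem //.
  by rewrite nth_index // dist_le_sym.
- by apply/exists_inP; exists z.
case/Q2P=> i si ei; have x0 : G by case: (s) si => [|y] //; rewrite ltn0.
apply/exists_inP; exists (nth x0 s i); first by apply: sP; rewrite mem_nth.
by apply/forallP=> k; rewrite dist_le_sym.
Qed.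

(** * Localization of first-order formulas *)

(** A witness close to [e] is found by a guarded quantifier. For a far witness, splitting turns [f]
    into products of a condition on [e] and one on the witness, leaving the existence of a far point
    in a definable set, which is [localizable_far]. *)
Lemma localizable_exists U n (f : lform U n.+2) :
  localizable (fun (G : graph) (c : coloring U G) (e : n.+1.-tuple G) =>
    [exists x, lholds c f [tuple of x :: e]]).
Proof.
pose s (k : 'I_n.+2) : 'I_n.+1 + 'I_1 :=
  if unlift ord0 k is Some k' then inl k' else inr ord0.
have jointE (G : graph) (e : n.+1.-tuple G) x :
    joint s e [tuple x] = [tuple of x :: e].
  apply: eq_from_tnth => k; rewrite tnth_mktuple /s.
  by case: unliftP => [k'|] ->; rewrite ?tnthS ?tnth0.
have [l lE] := lform_split f s; set r := radius f in lE.
pose near := lAny [seq LEx k r f | k : 'I_n.+1].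
pose Qfar (l : seq (lform U n.+1 * lform U 1)) (G : graph) (c : coloring U G)
    (e : n.+1.-tuple G) := has (fun p =>
  lholds c p.1 e && [exists z in [set z | lholds c p.2 [tuple z]], farb r e z]) l.
have loc : localizable
    (fun (G : graph) (c : coloring U G) e => lholds c near e || Qfar l G c e).
  apply: localizable_or; first exact: localizable_lform.
  elim: l {lE} => [|[g h] l IH].
    by apply: localizable_reduce (localizable_lform (LNot LTrue)) _ => G c; exists c.
  apply: localizable_or IH; apply: localizable_and.
    exact: localizable_lform.
  apply: localizable_reduce (@localizable_far n r) _ => G c.
  by exists [set z | lholds c h [tuple z]].
apply: localizable_reduce loc _ => G c; exists c => e.
rewrite lholds_any has_map.
apply/existsP/orP => [[x fx]|[/hasP[k _]|]].
- case: (boolP (farb r e x)) => [ex|].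
    right; move: fx; rewrite -jointE lE => [|i j]; last first.
      by rewrite [j]ord1 tnth0 (forallP ex).
    rewrite /Qfar /lsum; elim: l {lE} => //= p l IH /orP[|/IH ->].
      case/andP=> -> hx; apply/orP; left; apply/exists_inP.
      by exists x; rewrite ?inE.
    by rewrite orbT.
  rewrite negb_forall => /existsP[k]; rewrite negbK => kx; left.
  apply/hasP; exists k; first by rewrite -?enumT mem_enum.
  by rewrite [preim _ _ _]lholds_ex; apply/existsP; exists x; rewrite kx.
- rewrite [preim _ _ _]lholds_ex => /existsP[x /andP[_ fx]]; by exists x.
rewrite /Qfar => lfar; have {lfar} : exists2 x, farb r e x & lsum l c e [tuple x].
  elim: l lfar {lE} => //= p l IH /orP[/andP[p1 /exists_inP[x]]|/IH[x ex lx]].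
    by rewrite inE => p2 ex; exists x; rewrite // /lsum /= p1 p2.
  by exists x; rewrite // /lsum /= -/(lsum _ _ _ _) lx orbT.
case=> x ex lx; exists x; rewrite -jointE lE => // i j.
by rewrite [j]ord1 tnth0 (forallP ex).
Qed.

(** Successive complementations toggle a pair once for each set containing both ends, so only this
    parity matters. *)
Definition flips (T : finType) (Ms : seq {set T}) (x y : T) : bool :=
  foldr (fun (M : {set T}) b => ((x \in M) && (y \in M)) (+) b) false Ms.

Section Flip.
Variables (G : graph) (Ms : seq {set G}).

Definition flip_adj : rel G := fun x y => (x != y) && (adj x y (+) flips Ms x y).

Lemma flips_sym : symmetric (flips Ms).
Proof. by move=> x y; elim: Ms => //= M s ->; rewrite andbC. Qed.

Lemma flip_sym : symmetric flip_adj.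
Proof. by move=> x y; rewrite /flip_adj eq_sym adj_sym flips_sym. Qed.

Lemma flip_irr : irreflexive flip_adj.
Proof. by move=> x; rewrite /flip_adj eqxx. Qed.

Definition flip : graph := Graph flip_sym flip_irr.
End Flip.

Arguments flip : clear implicits.

(** With the [N] sets as colors, adjacency in the flipped graph is quantifier-free over [G], so the
    guards measure distances in the unflipped [G]. Universal quantifiers reduce to
    [localizable_exists] by negation; [0 < n] provides a variable to anchor the guards. *)
Lemma localizable_formula U N n (f : formula U n) : 0 < n ->
  localizable (fun (G : graph) (a : coloring U G * N.-tuple {set G}) e =>
    @holds U (flip G a.2) a.1 n f e).
Proof.
elim: f => {n} [n i j|n i j|n u i|n f IH|n f IHf g IHg|n f IH] n0 /=.
- by exists U, (LEq i j) => G [c Ms]; exists c.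
- exists 'I_N, (LAnd (LNot (LEq i j)) (lXor (LAdj i j)
    (foldr (fun k f => lXor (LAnd (LCol k i) (LCol k j)) f) (LNot LTrue)
      (enum 'I_N)))) => G [c Ms].
  exists (tnth Ms) => e; rewrite lholds_and lholds_not lholds_xor.
  rewrite /flip_adj; congr (_ && (_ (+) _)).
  rewrite -[in LHS](map_tnth_enum Ms); elim: (enum 'I_N) => // k s IH.
  by rewrite [map _ _]/= [flips _ _ _]/= [foldr _ _ _]/= lholds_xor IH.
- by exists U, (LCol u i) => G [c Ms]; exists c.
- exact: localizable_not (IH n0).
- exact: localizable_and (IHf n0) (IHg n0).
- case: n n0 f IH => // n _ f /(_ isT)[V [f' f'E]].
  apply: localizable_reduce (localizable_not (localizable_exists (LNot f'))) _.
  move=> G a; have [c cE] := f'E G a; exists c => e.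
  rewrite negb_exists; apply: eq_forallb => x.
  by rewrite /= negbK -cE.
Qed.

(** * Perturbations as flips *)

Lemma iso_refl G : iso G G.
Proof. by exists id => //; exists id. Qed.

Lemma iso_sym G H : iso G H -> iso H G.
Proof.
case=> f [g fK gK] fE; exists g; first by exists f.
by move=> x y; rewrite -fE !gK.
Qed.

Lemma iso_empty (G H : graph) : #|G| = 0 -> #|H| = 0 -> iso G H.
Proof.
move=> /card0_eq G0 /card0_eq H0.
have noG (x : G) : False by have := G0 x; rewrite inE.
have noH (x : H) : False by have := H0 x; rewrite inE.
exists (fun x => False_rect H (noG x)); last by move=> x; case: (noG x).
by exists (fun x => False_rect G (noH x)) => x; [case: (noG x)|case: (noH x)].
Qed.

Lemma iso_induced (G H : graph) (f : G -> H) (S : {set G}) (S' : {set H}) :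
  {in S &, injective f} -> S' = f @: S ->
  {in S &, forall x y, adj (f x) (f y) = adj x y} ->
  iso (induced S) (induced S').
Proof.
move=> f_inj defS' f_adj.
have fS (x : {x | x \in S}) : f (val x) \in S'.
  by rewrite defS' imset_f ?(valP x).
exists (fun x => Sub (f (val x)) (fS x)); last first.
  by move=> x y; apply: f_adj; apply: valP.
have gS (y : {y | y \in S'}) : {x | (x \in S) && (f x == val y)}.
  apply: sigW; have /imsetP[x Sx yx]: val y \in f @: S by rewrite -defS' (valP y).
  by exists x; rewrite Sx yx eqxx.
have gS' y : sval (gS y) \in S by have /andP[] := svalP (gS y).
have gE y : f (sval (gS y)) = val y by have /andP[_ /eqP] := svalP (gS y).
exists (fun y => Sub (sval (gS y)) (gS' y)) => [x|y]; apply: val_inj => /=.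
  by apply: f_inj; [exact: gS'|exact: valP|rewrite gE].
exact: gE.
Qed.

Lemma holds_iso U (G H : graph) (f : G -> H) (c : coloring U G)
    (d : coloring U H) :
  bijective f -> (forall x y, adj (f x) (f y) = adj x y) ->
  (forall u x, (f x \in d u) = (x \in c u)) ->
  forall n (p : formula U n) (e : n.-tuple G),
  holds d p [tuple of map f e] = holds c p e.
Proof.
move=> f_bij f_adj f_col n; have f_inj := bij_inj f_bij.
elim=> /= {n} [n i j|n i j|n u i|n p IH|n p IHp q IHq|n p IH] e;
  rewrite ?tnth_map ?f_adj ?f_col ?(inj_eq f_inj) ?IH ?IHp ?IHq //.
have IH' x : holds d p [tuple of f x :: map f e] = holds c p [tuple of x :: e].
  by rewrite -IH; congr (holds _ _ _); apply: val_inj.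
apply/forallP/forallP => pe x; first by rewrite -IH'.
by case: f_bij => g fK gK; rewrite -(gK x) IH'.
Qed.

Lemma iso_interpret U (I : interpretation U) (G H : graph) (c : coloring U G) :
  iso G H -> exists d : coloring U H, iso (interpret I c) (interpret I d).
Proof.
case=> f f_bij f_adj; pose d u := f @: c u; exists d.
have dE u x : (f x \in d u) = (x \in c u) by rewrite mem_imset //; apply: bij_inj.
have fE := holds_iso f_bij f_adj dE.
apply: (@iso_induced (eta_graph I c) (eta_graph I d) f).
- by move=> x y _ _; apply: bij_inj.
- case: f_bij (f_bij) => g fK gK f_bij; apply/setP=> y.
  rewrite -(gK y) mem_imset ?inE; last exact: bij_inj.
  by rewrite -fE; congr (holds _ _ _); apply: val_inj.
- move=> x y _ _; rewrite /= -fE; congr (holds _ _ _); exact: val_inj.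
Qed.

Lemma flips_cat (T : finType) (s t : seq {set T}) x y :
  flips (s ++ t) x y = flips s x y (+) flips t x y.
Proof. by elim: s => //= M s ->; rewrite addbA. Qed.

Lemma flips_map (T T' : finType) (h : {set T} -> {set T'}) s (x y : T) x' y' :
  (forall M, (x' \in h M) = (x \in M)) -> (forall M, (y' \in h M) = (y \in M)) ->
  flips (map h s) x' y' = flips s x y.
Proof. by move=> hx hy; elim: s => //= M s ->; rewrite hx hy. Qed.

Lemma flip_nil G : iso G (flip G [::]).
Proof.
exists id; first by exists id.
move=> x y /=; rewrite /flip_adj /= addbF.
by case: eqP => // ->; rewrite adj_irr.
Qed.

Lemma flip_flip (G : graph) (s t : seq {set G}) :
  iso (flip (flip G s) t) (flip G (s ++ t)).
Proof.
exists id; first by exists id.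
move=> x y /=; rewrite /flip_adj /= /flip_adj flips_cat addbA.
by case: eqP.
Qed.

Lemma iso_flip (G H : graph) (Ms : seq {set G}) : iso G H ->
  exists2 Ns : seq {set H}, size Ns = size Ms & iso (flip G Ms) (flip H Ns).
Proof.
case=> f f_bij f_adj; exists [seq f @: M | M : {set G} <- Ms]; first exact: size_map.
exists f => // x y; have f_inj := bij_inj f_bij.
rewrite /= /flip_adj (inj_eq f_inj) f_adj (@flips_map _ _ _ _ x y) // => M;
  exact: mem_imset.
Qed.

Lemma iso_complement (G : graph) (c : coloring unit (copies G 1)) :
  iso (interpret (interp subset_complementation) c)
      (flip G [:: [set x | (x, ord0) \in c tt]]).
Proof.
exists (fun x => (val x).1).
  have trivS (x : G) : (x, ord0 : 'I_1) \in
      [set z : copies G 1 | holds c (FEq ord0 ord0) [tuple z]].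
    by rewrite inE /= eqxx.
  exists (fun x => Sub (x, ord0) (trivS x)) => // x.
  by apply: val_inj => /=; case: (val x) => y i; rewrite (ord1 i).
move=> [[x i] xP] [[y j] yP]; rewrite [RHS]compl_etaE.
rewrite /= /flip_adj /= /copies_adj !inE xpair_eqE /= addbF.
by rewrite !(ord1 i, ord1 j) eqxx /= !andbF andbT orbF.
Qed.

(** Turns a chain of transductions into one flip on the original vertex set, by carrying the later
    sets back along the isomorphisms. *)
Lemma perturbsP m (G H : graph) : perturbs m G H <->
  exists2 Ms : seq {set G}, size Ms = m & iso H (flip G Ms).
Proof.
elim: m G => [|m IH] G /=; split.
- by move/iso_sym => HG; exists [::] => //; apply: iso_trans HG (flip_nil G).
- case=> Ms /size0nil -> HG; apply: iso_sym; apply: iso_trans HG _.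
  exact/iso_sym/flip_nil.
- case=> G' [c cE] /IH[Ms <- HG']; set M := [set x | (x, ord0) \in c tt].
  have [Ns sz G'M] := iso_flip Ms (iso_trans cE (iso_complement c)).
  exists (M :: Ns); first by rewrite /= sz.
  exact: iso_trans HG' (iso_trans G'M (flip_flip [:: M] Ns)).
case=> [[|M Ms] //= [sz] HG]; exists (flip G [:: M]); last first.
  by apply/IH; exists Ms => //; apply: iso_trans HG _; apply/iso_sym/flip_flip.
pose c (_ : unit) : {set copies G 1} := [set x | x.1 \in M].
exists c; apply: iso_sym.
have -> : M = [set x | (x, ord0) \in c tt] by apply/setP=> x; rewrite !inE.
exact: iso_complement.
Qed.

Lemma iso_copies (G H : graph) k : iso G H -> iso (copies G k) (copies H k).
Proof.
case=> f [g fK gK] f_adj; exists (fun x => (f x.1, x.2)).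
  by exists (fun x => (g x.1, x.2)) => -[x i] /=; rewrite ?fK ?gK.
by move=> x y; rewrite /= /copies_adj /= f_adj (can_eq fK).
Qed.

(** Each set is flipped in every copy separately, at the price of [k] sets. No lifted set meets two
    copies, so the edges between copies stay intact. *)
Lemma copies_flip (G : graph) k (Ms : seq {set G}) :
  exists2 Ns : seq {set copies G k}, size Ns = size Ms * k &
  iso (copies (flip G Ms) k) (flip (copies G k) Ns).
Proof.
pose lift (M : {set G}) (i : 'I_k) : {set copies G k} :=
  [set x | (x.1 \in M) && (x.2 == i)].
have liftE (x y : copies G k) : flips [seq lift M i | M <- Ms, i <- enum 'I_k] x y =
    (x.2 == y.2) && flips Ms x.1 y.1.
  elim: Ms => [|M Ms IH]; first by rewrite /= andbF.
  rewrite allpairs_cons flips_cat IH [flips (M :: _) _ _]/= andb_addr.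
  congr (_ (+) _); case: eqP => [xy|/eqP xy] /=.
    (* For two points in the same copy, only the index of that copy, listed exactly once, can
       contribute to the parity. *)
    have: x.2 \in enum 'I_k by rewrite mem_enum.
    have := enum_uniq 'I_k; elim: (enum 'I_k) => //= i s IHs /andP[si us].
    rewrite !inE -xy; case: eqP => [xi|_] /=; last by rewrite !andbF; apply: IHs.
    rewrite !andbT -[RHS]addbF => _; congr (_ (+) _); rewrite -xi in si.
    elim: s si {us IHs} => //= j s IHs; rewrite inE negb_or => /andP[ij /IHs ->].
    by rewrite !inE (negPf ij) !andbF.
  elim: (enum 'I_k) => //= i s ->; rewrite !inE.
  case: (x.2 =P i) => [<-|]; rewrite ?andbF //.
  by rewrite [y.2 == _]eq_sym (negPf xy) !andbF.
exists [seq lift M i | M <- Ms, i <- enum 'I_k].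
  by rewrite size_allpairs size_enum_ord.
exists id; first by exists id.
move=> x y; rewrite /= /flip_adj /copies_adj /= /flip_adj liftE.
case: x y => [x i] [y j]; rewrite xpair_eqE /=.
by rewrite /copies_adj /=; case: (i =P j); case: (x =P y) => //=; rewrite !orbF.
Qed.

Fixpoint fdist U n s (i j : 'I_n) : formula U n :=
  if s is s'.+1 then
    FNot (FAnd (FNot (FEq i j)) (FAll (FNot
      (FAnd (FAdj (lift ord0 i) ord0) (fdist U s' ord0 (lift ord0 j))))))
  else FEq i j.

Lemma holds_dist U (G : graph) (c : coloring U G) n s (i j : 'I_n) e :
  holds c (fdist U s i j) e = dist_le s (tnth e i) (tnth e j).
Proof.
elim: s n i j e => [|s IH] n i j e /=.
  apply/eqP/dist_leP => [ij|[[|x p] []] //].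
  by exists [::]; rewrite -ij.
rewrite negb_and negbK negb_forall.
apply/orP/dist_leP => [[/eqP ->|/existsP[x]]|[[|x p] [ps ip pj]]].
- by exists [::].
- rewrite negbK IH !tnthS tnth0 => /andP[ix /dist_leP[p [ps xp pj]]].
  by exists (x :: p); rewrite /= ix.
- by left; apply/eqP.
right; apply/existsP; exists x; rewrite negbK IH !tnthS tnth0.
case/andP: ip => -> xp; apply/dist_leP; by exists p.
Qed.

(** Interpretations consist of plain formulas, so local ones are translated back. The constant
    becomes a quantified equality, available even without free variables. *)
Fixpoint lform_formula U n (f : lform U n) : formula U n :=
  match f with
  | LTrue _ => FAll (FEq ord0 ord0)
  | LEq _ i j => FEq i j
  | LAdj _ i j => FAdj i j
  | LCol _ u i => FCol u i
  | LNot _ f1 => FNot (lform_formula f1)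
  | LAnd _ f1 f2 => FAnd (lform_formula f1) (lform_formula f2)
  | LEx _ i s f1 => FNot (FAll (FNot (FAnd
      (fdist U s (lift ord0 i) ord0) (lform_formula f1))))
  end.

Lemma holds_lform U (G : graph) (c : coloring U G) n (f : lform U n) e :
  holds c (lform_formula f) e = lholds c f e.
Proof.
elim: f e => {n} [n|n i j|n i j|n u i|n f IH|n f IHf g IHg|n i s f IH] e //=.
- by apply/forallP.
- by rewrite IH.
- by rewrite IHf IHg.
rewrite negb_forall; apply: eq_existsb => x.
by rewrite negbK holds_dist tnthS tnth0 IH.
Qed.

(** * Local transductions *)

Definition pairs_or U (l : seq (lform U 1 * lform U 1)) (G : graph)
    (c : coloring U G) (x y : G) :=
  lsum l c [tuple x] [tuple y] || lsum l c [tuple y] [tuple x].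

Definition parity U (fs : seq (lform U 1)) (G : graph) (c : coloring U G)
    (x y : G) :=
  flips [seq [set z | lholds c f [tuple z]] | f <- fs] x y.

Lemma parity_cons U f (fs : seq (lform U 1)) (G : graph) (c : coloring U G) x y :
  parity (f :: fs) c x y =
  (lholds c f [tuple x] && lholds c f [tuple y]) (+) parity fs c x y.
Proof. by rewrite /parity /= !inE. Qed.

Lemma parity_cat U (fs gs : seq (lform U 1)) (G : graph) (c : coloring U G) x y :
  parity (fs ++ gs) c x y = parity fs c x y (+) parity gs c x y.
Proof. by rewrite /parity map_cat flips_cat. Qed.

(** A parity is a sum of terms [f(x) f(y)] over the two-element field, and the product of two such
    terms is the term of [LAnd f g]. *)
Lemma parity_allpairs U (fs gs : seq (lform U 1)) (G : graph)
    (c : coloring U G) x y :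
  parity [seq LAnd f g | f <- fs, g <- gs] c x y =
  parity fs c x y && parity gs c x y.
Proof.
elim: fs => [|f fs IH] //; rewrite allpairs_cons parity_cat IH.
rewrite parity_cons andb_addl; congr (_ (+) _).
elim: gs {IH} => [|g gs IH]; first by rewrite andbF.
by rewrite [map _ _]/= !parity_cons IH !lholds_and andb_addr andbACA.
Qed.

(** Over the two-element field, the disjunction of [a] and [b] is [a + b + ab]. *)
Lemma parity_or U (fs gs : seq (lform U 1)) : exists hs,
  forall (G : graph) (c : coloring U G) x y,
  parity hs c x y = parity fs c x y || parity gs c x y.
Proof.
exists (fs ++ (gs ++ [seq LAnd f g | f <- fs, g <- gs])) => G c x y.
rewrite !parity_cat parity_allpairs.
by case: (parity fs c x y); case: (parity gs c x y).
Qed.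

(* Over the two-element field, with A, B the characteristic functions of the
   sets defined by f and g, the polarization of the quadratic form x |-> x^2
   gives A(x)B(y) + A(y)B(x) = (A+B)(x)(A+B)(y) + A(x)A(y) + B(x)B(y); the
   product of the two summands on the left is (AB)(x)(AB)(y). *)
Lemma pairs_or_parity U (l : seq (lform U 1 * lform U 1)) : exists fs,
  forall (G : graph) (c : coloring U G) x y,
  parity fs c x y = pairs_or l c x y.
Proof.
elim: l => [|[f g] l [fs fsE]]; first by exists [::].
have [hs hsE] := parity_or [:: LAnd f g; lXor f g; f; g] fs.
exists hs => G c x y; rewrite hsE fsE /pairs_or /lsum /= orbACA.
congr (_ || _); rewrite !parity_cons !lholds_xor !lholds_and addbF.
by case: (lholds c f [tuple x]); case: (lholds c f [tuple y]);
  case: (lholds c g [tuple x]); case: (lholds c g [tuple y]).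
Qed.

Definition lparity U (fs : seq (lform U 1)) : lform U 2 :=
  foldr (fun f => lXor (LAnd (lrename f (fun=> ord0)) (lrename f (fun=> ord_max))))
    (LNot LTrue) fs.

Lemma lholds_parity U fs (G : graph) (c : coloring U G) x y :
  lholds c (lparity fs) [tuple x; y] = parity fs c x y.
Proof.
elim: fs => // f fs IH; rewrite [lparity _]/= lholds_xor lholds_and IH !lholds_rename.
rewrite parity_cons; congr (_ && _ (+) _);
  by congr (lholds _ _ _); apply: eq_from_tnth => i; rewrite tnth_mktuple ord1.
Qed.

Definition image_class_in (T : transduction) (D : graph_class) (H : graph) :=
  #|H| = 0 \/ exists2 G, D G & transduces T G H.

Lemma image_class_iso T D G H :
  iso G H -> image_class_in T D G -> image_class_in T D H.
Proof.
move=> GH [G0|[K DK [c KG]]].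
  by left; case: GH => f bf _; rewrite -(bij_eq_card bf).
by right; exists K => //; exists c; apply: iso_trans KG; apply: iso_sym.
Qed.

Lemma image_class_empty T D (G : graph) : #|G| = 0 -> image_class_in T D G.
Proof. by left. Qed.

Definition image_class T D :=
  GraphClass (@image_class_iso T D) (@image_class_empty T D).

Section LocalTransduction.
Variables (U : Type) (t : lform U 2) (r k : nat).
Hypothesis t_sym : forall (G : graph) (c : coloring U G) (x y : G),
  lholds c t [tuple x; y] = lholds c t [tuple y; x].
Hypothesis t_irr : forall (G : graph) (c : coloring U G) (x : G),
  lholds c t [tuple x; x] = false.
Hypothesis t_near : forall (G : graph) (c : coloring U G) (x y : G),
  lholds c t [tuple x; y] -> dist_le r x y.
Hypothesis k_gt0 : 0 < k.

Let eta0 : formula (option U) 2 := lform_formula (lmap some t).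

Let etaE (G : graph) (c : coloring (option U) G) (x y : G) :
  holds c eta0 [tuple x; y] = lholds (fun u => c (Some u)) t [tuple x; y].
Proof. by rewrite holds_lform lholds_map. Qed.

Let eta_sym0 (G : graph) (c : coloring (option U) G) (x y : G) :
  holds c eta0 [tuple x; y] = holds c eta0 [tuple y; x].
Proof. by rewrite !etaE t_sym. Qed.

Let eta_irr0 (G : graph) (c : coloring (option U) G) (x : G) :
  holds c eta0 [tuple x; x] = false.
Proof. by rewrite etaE t_irr. Qed.

(** Vertices are selected by the fresh color [None], so that any vertex set, however defined, can be
    supplied through the coloring. *)
Definition local_interpretation :=
  Interpretation (FCol None ord0) eta_sym0 eta_irr0.

Definition local_transduction := Transduction k_gt0 local_interpretation.

Lemma local_adj (G : graph) (c : coloring (option U) G)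
    (x y : interpret local_interpretation c) :
  adj x y = lholds (fun u => c (Some u)) t [tuple val x; val y].
Proof. exact: etaE. Qed.

(** Edges given by [t] span distance at most [r] in the copies, so a ball of radius [d] reaches at
    most [d * r]. The extra [radius t] lets [t] be evaluated inside the ball of [G]. *)
Lemma ball_local_transduction d (G : graph)
    (c : coloring (option U) (copies G k))
    (v : interpret local_interpretation c) :
  transduces local_transduction (ball (d * r + radius t) (val v).1) (ball d v).
Proof.
set I := local_interpretation; set g := (val v).1.
set B := ball _ g; pose K := copies G k.
pose Y : {set K} := [set val u | u in [set u | dist_le d v u]].
pose h (x : copies B k) : K := (val x.1, x.2).
(* [None] now marks only the ball [Y], not the whole interpreted graph; the other colors are pulled
   back unchanged. *)
pose cB (u : option U) : {set copies B k} :=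
  if u is Some _ then h @^-1: c u else h @^-1: Y.
have h_inj : injective h by case=> x i [y j] [/val_inj -> ->].
have h_adj x y : adj (h x) (h y) = adj x y.
  by rewrite /= /copies_adj /= (inj_eq val_inj).
have Ynear y : y \in Y -> @dist_le K (d * r) (val v) y.
  case/imsetP=> u; rewrite inE => vu ->; apply: dist_le_map vu => x z.
  by rewrite local_adj; apply: t_near.
(* Projecting to [G] does not increase distances: an edge between copies collapses to a vertex. *)
have base s (y z : K) : dist_le s y z -> dist_le s y.1 z.1.
  move=> yz; rewrite -[s]muln1; apply: dist_le_map yz => a b.
  case/orP=> [/andP[_]|/andP[/eqP-> _]]; last exact: dist_le0.
  exact: dist_le1.
have Bh y : @dist_le K (d * r + radius t) (val v) y -> exists x, h x = y.
  move=> /base vy.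
  have yB : y.1 \in [set u | dist_le (d * r + radius t) g u] by rewrite inE.
  by exists (Sub y.1 yB, y.2); rewrite /h /=; case: (y).
exists cB; apply: (@iso_trans _ (@induced (eta_graph I c) Y)).
  by apply: iso_induced => // x y _ _; apply: val_inj.
apply: iso_sym.
apply: (@iso_induced (eta_graph I cB) (eta_graph I c) h).
- by move=> x y _ _; apply: h_inj.
- apply/setP=> y; apply/idP/imsetP => [yY|[x]]; last first.
    by rewrite inE /= inE => xY ->.
  have [|x xy] := Bh y; first by apply: dist_le_sub (Ynear y yY); rewrite leq_addr.
  by exists x; rewrite // inE /= inE xy.
- move=> x y; rewrite !inE /= !inE => xY yY; rewrite !etaE.
  have cE u z : (z \in cB (Some u)) = (h z \in c (Some u)) by rewrite inE.
  rewrite -(lholds_embed h_inj h_adj cE) => [|i z iz].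
    by congr (lholds _ _ _); apply: val_inj.
  apply: Bh; apply: dist_le_trans iz; apply: Ynear.
  by case: (unliftP ord0 i) => [j|] ->; rewrite ?tnthS ?tnth0 // ord1.
Qed.

(** One and the same transduction produces all balls of radius [d] of the image from larger balls of
    [D], whose class is in [P]. *)
Lemma loc_local_transduction P D : transduction_downset P -> loc P D ->
  loc P (image_class local_transduction D).
Proof.
move=> hP locD d; apply: hP (locD (d * r + radius t)) _.
exists local_transduction => H [H0|[G [v [[G0|[K DK [c [f [f' fK f'K] fE]]]] vH]]]].
(* The empty graph is in [balls] without being a ball; it is obtained from the empty graph. *)
- pose Z : graph := @Graph void (fun _ _ => false) (fun _ _ => erefl) (fun=> erefl).
  exists Z; first by left; rewrite card_void.
  exists (fun=> set0); apply: iso_empty => //.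
  by apply: eq_card0 => -[[[]]].
- by move/card0_eq: G0 => /(_ v); rewrite inE.
exists (ball (d * r + radius t) (val (f v)).1).
  by right; exists K, (val (f v)).1; split=> //; apply: iso_refl.
have [c' c'E] := ball_local_transduction d (f v).
exists c'; apply: iso_trans c'E; apply: iso_trans (iso_sym vH) _.
have f_inj := can_inj fK.
apply: (@iso_induced _ _ f) => [x y _ _|| x y _ _]; [exact: f_inj| |exact: fE].
apply/setP=> y; rewrite -[y]f'K mem_imset // !inE; apply/idP/idP => vy.
  rewrite -(fK v) -(fK (f' y)) -[d]muln1; apply: dist_le_map vy => a b ab.
  by apply: dist_le1; rewrite -fE !f'K.
by rewrite -[d]muln1; apply: dist_le_map vy => a b ab; apply: dist_le1; rewrite fE.
Qed.

End LocalTransduction.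

(** * Decomposition of an edge formula into near edges and flips *)

Definition side (k : 'I_2) : 'I_1 + 'I_1 :=
  if k == ord0 then inl ord0 else inr ord0.

Lemma joint_side T (x y : T) : joint side [tuple x] [tuple y] = [tuple x; y].
Proof.
by apply: eq_from_tnth => k; rewrite tnth_mktuple /side; case: k => [[|[|]]].
Qed.

(** Splitting makes [f] a disjunction of products on far pairs, hence a parity once symmetrized; [t]
    corrects that parity on near pairs. *)
Lemma local_decomposition U (f : lform U 2) :
  exists r (t : lform U 2) (fs : seq (lform U 1)),
  forall (G : graph) (c : coloring U G) (x y : G),
  [/\ lholds c t [tuple x; y] = lholds c t [tuple y; x],
      lholds c t [tuple x; x] = false,
      lholds c t [tuple x; y] -> dist_le r x y &
      x != y ->
      (forall x y : G, lholds c f [tuple x; y] = lholds c f [tuple y; x]) ->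
      lholds c f [tuple x; y] = lholds c t [tuple x; y] (+) parity fs c x y].
Proof.
have [l lE] := lform_split f side; have [fs fsE] := pairs_or_parity l.
pose q := lXor f (lparity fs).
(* An interpretation must be symmetric and anti-reflexive for every coloring, while [f] is only
   assumed symmetric for some; hence the inequality and the conjunction with the swapped [q]. *)
pose t := LAnd (LNot (LEq ord0 ord_max)) (LAnd (lDist U (radius f) ord0 ord_max)
  (LAnd q (lrename q (@rev_ord 2)))).
have qE (G : graph) (c : coloring U G) x y :
    lholds c q [tuple x; y] = lholds c f [tuple x; y] (+) parity fs c x y.
  by rewrite lholds_xor lholds_parity.
have tE (G : graph) (c : coloring U G) x y : lholds c t [tuple x; y] =
    [&& x != y, dist_le (radius f) x y, lholds c q [tuple x; y]
      & lholds c q [tuple y; x]].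
  rewrite !lholds_and lholds_dist lholds_rename; congr [&& _, _, _ & lholds _ _ _].
  by apply: eq_from_tnth => i; rewrite tnth_mktuple; case: i => [[|[|]]].
exists (radius f), t, fs => G c x y; rewrite !tE; split.
- by rewrite eq_sym dist_le_sym [lholds c q _ && _]andbC.
- by rewrite eqxx.
- by case/and4P.
move=> xy f_sym; rewrite xy andTb !qE [lholds c f [tuple y; x]]f_sym.
have -> : parity fs c y x = parity fs c x y by apply: flips_sym.
(* On near pairs the two parities cancel. On far pairs [t] is false, and by symmetry of [f] both
   orders of the splitting give its value. *)
rewrite andbb; case: (boolP (dist_le _ x y)) => [_|xyfar].
  by rewrite andTb -addbA addbb addbF.
have farxy (a b : G) : ~~ dist_le (radius f) a b ->
    far (radius f) [tuple a] [tuple b].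
  by move=> ab i j; rewrite !ord1.
rewrite andFb addFb fsE /pairs_or -!lE ?joint_side;
  rewrite ?[lholds c f [tuple y; x]]f_sym ?orbb //.
  by apply: farxy; rewrite dist_le_sym.
exact: farxy.
Qed.

Theorem theorem19p1 (P : class_property) (hP : transduction_downset P) :
  transduction_downset (perturbation_closure (loc P)).
Proof.
move=> C D0 [D locD [m Dm]] [[k k_gt0 V I] /= CT].
(* The [m] flips of a graph become [m * k] flips of its [k] copies. *)
have [U [f fE]] := localizable_formula (m * k) (eta I) isT.
have [r [t [fs tE]]] := local_decomposition f.
have t_sym (G : graph) (c : coloring U G) x y :
  lholds c t [tuple x; y] = lholds c t [tuple y; x] by case: (tE G c x y).
have t_irr (G : graph) (c : coloring U G) x : lholds c t [tuple x; x] = false.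
  by case: (tE G c x x).
have t_near (G : graph) (c : coloring U G) x y :
  lholds c t [tuple x; y] -> dist_le r x y by case: (tE G c x y).
pose T := local_transduction t_sym t_irr k_gt0.
exists (image_class T D).
  exact (loc_local_transduction t_sym t_irr t_near k_gt0 hP locD).
(* The number of complementations is fixed before [H], as a perturbation requires. *)
exists (size fs) => H /CT[G0 /Dm[G DG /perturbsP[Ms sM G0M]] [c0 Hc0]].
have [Ns sN GN] := copies_flip k Ms; rewrite sM in sN.
have [c1 c01] := iso_interpret I c0 (iso_trans (iso_copies k G0M) GN).
have {Hc0 c01} Hc1 := iso_trans Hc0 c01.
pose K := copies G k; have [c cE] := fE K (c1, Tuple (introT eqP sN)).
(* The formula [nu I] is evaluated in the flipped graph and is not localized: its set [X] is handed
   over as color [None]. *)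
pose X : {set K} := [set x | holds c1 (nu I) [tuple x]].
pose d (u : option U) : {set K} := if u is Some u then c u else X.
pose J := interp T; pose H' := interpret J d.
exists H'; first by right; exists G => //; exists d; apply: iso_refl.
apply/perturbsP.
exists [seq [set x : H' | lholds c f [tuple val x]] | f <- fs]; first exact: size_map.
apply: iso_trans Hc1 _.
have inX (x : H') : val x \in [set x | holds c1 (nu I) [tuple x]].
  by have := valP x; rewrite inE /= inE.
have inH' (x : interpret I c1) : val x \in [set x : K | holds d (nu J) [tuple x]].
  by have := valP x; rewrite [in X in _ -> X]inE /= !inE.
apply: iso_sym; exists (fun x => Sub (val x) (inX x)).
  by exists (fun x => Sub (val x) (inH' x)) => x; apply: val_inj.
have eta_f (x y : K) : holds c1 (eta I) [tuple x; y] = lholds c f [tuple x; y].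
  exact: cE.
move=> x y; rewrite /= /flip_adj; transitivity (lholds c f [tuple val x; val y]).
  exact: eta_f.
have -> : flips [seq [set x : H' | lholds c f [tuple val x]] | f <- fs] x y =
    parity fs c (val x) (val y).
  by elim: (fs) => // g s IH; rewrite parity_cons /= IH !inE.
(* The decomposition concerns distinct vertices; on the diagonal both sides are false. *)
case: (x =P y) => [<-|/eqP xy]; first by rewrite -eta_f eta_irr.
have [_ _ _ ->] := tE K c (val x) (val y); last first.
- by move=> a b; rewrite -!eta_f eta_sym.
- by rewrite (inj_eq val_inj).
by rewrite local_adj.
Qed.
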